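(* Let $D$ be a signed digraph on $[n]$ and $s\ge2$. For every non-empty independent set $Z$ of the guessing graph $\mathrm{G}(D,s)$ there exists $f\in F(D,s)$ such that $Z\subseteq\mathrm{Fix}(f)$. Consequently $g(D,s)=\log_s\alpha(\mathrm{G}(D,s))$, where $\alpha$ denotes the independence number.
   Context: A signed digraph on $[n]=\{0,\dots,n-1\}$ is $D=([n],E,\lambda)$ with $E\subseteq[n]\times[n]$ (loops allowed) and $\lambda:E\to\{-1,0,1\}$. For $i\in[n]$, $N^\alpha(i)=\{j:(j,i)\in E,\lambda(j,i)=\alpha\}$ and $N(i)$ is their union. $[s]=\{0,\dots,s-1\}$. $F(D,s)$ is the set of maps $f=(f_0,\dots,f_{n-1}):[s]^n\to[s]^n$ such that each $f_i$ depends only on $x_{N(i)}$, is non-decreasing in $x_j$ when $\lambda(j,i)=1$ and non-increasing in $x_j$ when $\lambda(j,i)=-1$. $\mathrm{Fix}(f)$ is the set of fixed points of $f$, and $g(D,s)=\max_{f\in F(D,s)}\log_s|\mathrm{Fix}(f)|$. The guessing graph $\mathrm{G}(D,s)$ is the simple graph on $[s]^n$ where distinct $x,y$ are adjacent iff no $f\in F(D,s)$ has both $x,y\in\mathrm{Fix}(f)$. *)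

(* Defs.v *)
From mathcomp Require Import all_boot all_order all_algebra.
From mathcomp Require Import reals ereal exp.
Set Implicit Arguments.
Unset Strict Implicit.
Unset Printing Implicit Defensive.

Import Order.TTheory GRing.Theory Num.Theory.

(* The labelling is total; its values outside [arcs] are never consulted. *)
Record signed_digraph (n : nat) := SignedDigraph {
  arcs : {set 'I_n * 'I_n};
  label : 'I_n -> 'I_n -> int;
  labelP : forall j i, (j, i) \in arcs -> label j i \in [:: (-1)%R; 0%R; 1%R]
}.

(* in-neighbours of [i] along an arc labelled [a] *)
Definition nbr_sign n (D : signed_digraph n) (a : int) (i : 'I_n) : {set 'I_n} :=
  [set j | ((j, i) \in arcs D) && (label D j i == a)].

Definition nbr n (D : signed_digraph n) (i : 'I_n) : {set 'I_n} :=
  nbr_sign D (-1)%R i :|: nbr_sign D 0%R i :|: nbr_sign D 1%R i.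

Definition conf (n s : nat) := {ffun 'I_n -> 'I_s}.

Definition agree_on n s (A : {set 'I_n}) (x y : conf n s) : bool :=
  [forall j in A, x j == y j].

(* In the next three definitions [f x i] is the local function f_i at x. *)
Definition depends_only_on n s (f : {ffun conf n s -> conf n s})
    (i : 'I_n) (A : {set 'I_n}) : bool :=
  [forall x : conf n s, forall y : conf n s,
     agree_on A x y ==> (f x i == f y i)].

Definition nondecreasing_in n s (f : {ffun conf n s -> conf n s})
    (i j : 'I_n) : bool :=
  [forall x : conf n s, forall y : conf n s,
     agree_on [set~ j] x y && (x j <= y j)%N ==> (f x i <= f y i)%N].

Definition nonincreasing_in n s (f : {ffun conf n s -> conf n s})
    (i j : 'I_n) : bool :=
  [forall x : conf n s, forall y : conf n s,
     agree_on [set~ j] x y && (x j <= y j)%N ==> (f y i <= f x i)%N].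

Definition networks n (D : signed_digraph n) (s : nat) :
    {set {ffun conf n s -> conf n s}} :=
  [set f | [forall i,
    [&& depends_only_on f i (nbr D i),
        [forall j in nbr_sign D 1%R i, nondecreasing_in f i j]
      & [forall j in nbr_sign D (-1)%R i, nonincreasing_in f i j]]]].

Definition Fix n s (f : {ffun conf n s -> conf n s}) : {set conf n s} :=
  [set x | f x == x].

Record sgraph (T : finType) := SGraph {
  adj : rel T;
  adj_sym : symmetric adj;
  adj_irr : irreflexive adj
}.

Definition independent (T : finType) (G : sgraph T) (A : {set T}) : bool :=
  [forall x in A, forall y in A, ~~ adj G x y].

Definition independence_number (T : finType) (G : sgraph T) : nat :=
  \max_(A : {set T} | independent G A) #|A|.

Definition guessing_adj n (D : signed_digraph n) (s : nat) : rel (conf n s) :=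
  fun x y =>
    (x != y) && ~~ [exists f in networks D s, (x \in Fix f) && (y \in Fix f)].

Lemma guessing_adj_sym n (D : signed_digraph n) s : symmetric (guessing_adj D (s := s)).
Proof.
move=> x y; rewrite /guessing_adj eq_sym; congr (_ && ~~ _).
by apply: eq_existsb => f; rewrite [(x \in _) && _]andbC.
Qed.

Lemma guessing_adj_irr n (D : signed_digraph n) s : irreflexive (guessing_adj D (s := s)).
Proof. by move=> x; rewrite /guessing_adj eqxx. Qed.

Definition guessing_graph n (D : signed_digraph n) (s : nat) : sgraph (conf n s) :=
  SGraph (@guessing_adj_sym n D s) (@guessing_adj_irr n D s).

(* Extended-real valued, so that the logarithm of 0 is -oo: a map without
   fixed points never contributes to the maximum in [guessing_number]. *)
Definition log_base (R : realType) (s m : nat) : \bar R :=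
  (lne (m%:R)%:E / (ln s%:R)%:E)%E.

Definition guessing_number (R : realType) n (D : signed_digraph n) (s : nat) :
    \bar R :=
  \big[maxe/-oo%E]_(f in networks D s) log_base R s #|Fix f|.

(* Main.v *)
(* For each vertex i let x <=_i y mean that, on the in-neighbours j of i,
   x_j <= y_j along positive arcs, y_j <= x_j along negative arcs and
   x_j = y_j along 0-arcs.  Then f belongs to F(D, s) iff every f_i is monotone
   from <=_i to <=.  So if any two points of Z are fixed by a common network,
   z |-> z_i is monotone for <=_i on Z, and it extends to all configurations by
   f_i(x) = max {z_i : z in Z, z <=_i x}. *)
Require Import Defs.
From mathcomp Require Import all_boot all_order all_algebra.
From mathcomp Require Import reals ereal exp.

Import Order.TTheory GRing.Theory Num.Theory.

Section Networks.
Context {n s : nat} {D : signed_digraph n}.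
Implicit Types (i j : 'I_n) (x y z : conf n s).
Implicit Types (f : {ffun conf n s -> conf n s}) (Z : {set conf n s}).

(* The two inequalities along a 0-arc give equality. *)
Definition local_le i x y : bool :=
  [forall j, ((j, i) \in arcs D) ==>
     ((label D j i != (-1)%R) ==> (x j <= y j)%N) &&
     ((label D j i != 1%R) ==> (y j <= x j)%N)].

Lemma local_leP i x y :
  reflect (forall j, (j, i) \in arcs D ->
             (label D j i != (-1)%R -> (x j <= y j)%N) /\
             (label D j i != 1%R -> (y j <= x j)%N))
          (local_le i x y).
Proof.
apply: (iffP forallP) => h j.
  by move=> ji; move: (h j); rewrite ji => /andP[/implyP h1 /implyP h2].
apply/implyP => ji; have [h1 h2] := h j ji.
by apply/andP; split; apply/implyP.
Qed.

Lemma local_le_refl i : reflexive (local_le i).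
Proof. by move=> x; apply/local_leP => j _. Qed.

Lemma local_le_trans i : transitive (local_le i).
Proof.
move=> y x z /local_leP xy /local_leP yz; apply/local_leP => j ji.
have [xy1 xy2] := xy j ji; have [yz1 yz2] := yz j ji.
split=> h; first exact: leq_trans (xy1 h) (yz1 h).
exact: leq_trans (yz2 h) (xy2 h).
Qed.

Lemma in_nbr i j : (j \in nbr D i) = ((j, i) \in arcs D).
Proof.
rewrite !inE; case ji: (_ \in _) => //=.
by have := labelP ji; rewrite !inE orbA.
Qed.

Lemma agree_on_local_le i x y : agree_on (nbr D i) x y -> local_le i x y.
Proof.
move=> /forallP xy; apply/local_leP => j ji.
by have := xy j; rewrite in_nbr ji => /eqP ->.
Qed.

Lemma agree_onC (A : {set 'I_n}) x y : agree_on A x y = agree_on A y x.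
Proof. by apply: eq_forallb => j; rewrite eq_sym. Qed.

Lemma agree_onC1P j x y :
  reflect (forall k, k != j -> x k = y k) (agree_on [set~ j] x y).
Proof.
apply: (iffP forallP) => h k.
  by move=> kj; move: (h k); rewrite !inE kj => /eqP.
by rewrite !inE; apply/implyP => /h ->.
Qed.

(** Agreement on the in-neighbours gives [local_le] both ways, hence equal values. Raising
    coordinate [j] alone moves up in [local_le i] along a positive arc and down along a negative
    one. *)
Lemma monotone_network f :
  (forall i x y, local_le i x y -> (f x i <= f y i)%N) -> f \in networks D s.
Proof.
move=> mono; rewrite inE; apply/forallP => i; apply/and3P; split.
- apply/forallP => x; apply/forallP => y; apply/implyP => xy.
  rewrite -val_eqE /= eqn_leq; apply/andP.
  by split; apply/mono/agree_on_local_le; last rewrite agree_onC.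
- apply/forallP => j; apply/implyP; rewrite inE => /andP[ji /eqP lj].
  apply/forallP => x; apply/forallP => y; apply/implyP.
  move=> /andP[/agree_onC1P xy le_xy]; apply/mono/local_leP => k ki.
  have [->|kj] := eqVneq k j; first by rewrite lj.
  by rewrite xy.
- apply/forallP => j; apply/implyP; rewrite inE => /andP[ji /eqP lj].
  apply/forallP => x; apply/forallP => y; apply/implyP.
  move=> /andP[/agree_onC1P xy le_xy]; apply/mono/local_leP => k ki.
  have [->|kj] := eqVneq k j; first by rewrite lj.
  by rewrite xy.
Qed.

(** The label of the arc from [j] to [i], if there is one, decides which defining condition of
    [networks] applies. *)
Lemma network_step f i j x y : f \in networks D s ->
  local_le i x y -> agree_on [set~ j] x y -> (f x i <= f y i)%N.
Proof.
rewrite inE => /forallP /(_ i) /and3P[/forallP dep /forallP inc /forallP dec].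
move=> /local_leP le_xy xy.
have [ji|Nji] := boolP ((j, i) \in arcs D); last first.
  (* Without this arc, [x] and [y] agree on all in-neighbours of [i]. *)
  have /forallP /(_ y) /implyP /(_ _) /eqP -> // := dep x.
  apply/forallP => k; apply/implyP; rewrite in_nbr => ki.
  apply/eqP; move/agree_onC1P: xy; apply.
  by apply: contraNneq Nji => <-.
have [le1 le2] := le_xy j ji.
have := labelP ji; rewrite !inE => /or3P[] /eqP lj.
(* Here [local_le] gives [y j <= x j], so the condition is used with the points swapped. *)
- have := dec j; rewrite inE ji lj eqxx /= => /forallP /(_ y) /forallP /(_ x).
  by move=> /implyP; apply; rewrite agree_onC xy le2 // lj.
- have /forallP /(_ y) /implyP /(_ _) /eqP -> // := dep x.
  apply/forallP => k; apply/implyP => _; apply/eqP.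
  have [->|kj] := eqVneq k j; last by move/agree_onC1P: xy; apply.
  by apply/val_inj/eqP; rewrite /= eqn_leq le1 ?le2 // lj.
- have := inc j; rewrite inE ji lj eqxx /= => /forallP /(_ x) /forallP /(_ y).
  by move=> /implyP; apply; rewrite xy le1 // lj.
Qed.

(* Walk from x to y, correcting one differing coordinate at a time. *)
Lemma network_monotone f i x y :
  f \in networks D s -> local_le i x y -> (f x i <= f y i)%N.
Proof.
move=> fD; have [m] := ubnP #|[set j | x j != y j]|.
elim: m x => // m IHm x; rewrite ltnS => le_m le_xy.
have [xy|] := eqVneq [set j | x j != y j] set0.
  suff -> : x = y by [].
  by apply/ffunP => j; apply/eqP; move/setP/(_ j): xy; rewrite !inE => /negbFE.
case/set0Pn => j; rewrite inE => xyj.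
pose x' : conf n s := [ffun k => if k == j then y k else x k].
(* Each coordinate of [x'] comes from [x] or [y], so [x'] lies between them for [local_le i]. *)
have xx' : local_le i x x'.
  apply/local_leP => k ki; rewrite ffunE; case: (eqVneq k j) => // _.
  by move/local_leP: le_xy; apply.
have x'y : local_le i x' y.
  apply/local_leP => k ki; rewrite ffunE; case: (eqVneq k j) => // _.
  by move/local_leP: le_xy; apply.
apply: (@leq_trans (f x' i)).
  apply: (network_step f i j) => //.
  by apply/agree_onC1P => k /negPf kj; rewrite ffunE kj.
apply: IHm => //; apply: leq_trans le_m; apply: proper_card.
apply/properP; split; last by exists j; rewrite !inE // ffunE !eqxx.
by apply/subsetP => k; rewrite !inE ffunE; case: (eqVneq k j) => // _; rewrite eqxx.
Qed.

Lemma independentP Z :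
  reflect {in Z &, forall x y, x != y ->
             exists2 f, f \in networks D s & (x \in Fix f) && (y \in Fix f)}
          (independent (guessing_graph D s) Z).
Proof.
apply: (iffP forall_inP) => [h x y xZ yZ xy | h x xZ].
  have /forall_inP /(_ y yZ) := h x xZ.
  by rewrite /= /guessing_adj xy negbK => /exists_inP.
apply/forall_inP => y yZ; rewrite /= /guessing_adj negb_and !negbK.
have [//|xy /=] := eqVneq x y.
by apply/exists_inP; exact: h.
Qed.

Lemma independent_Fix f :
  f \in networks D s -> independent (guessing_graph D s) (Fix f).
Proof. by move=> fD; apply/independentP => x y xf yf _; exists f; rewrite ?xf. Qed.

(** A network fixing both points turns [x i] and [y i] into its values there, and these are
    monotone. *)
Lemma independent_local_le Z i : independent (guessing_graph D s) Z ->
  {in Z &, forall x y, local_le i x y -> (x i <= y i)%N}.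
Proof.
move=> /independentP indZ x y xZ yZ le_xy.
have [->//|xy] := eqVneq x y.
have [f fD] := indZ x y xZ yZ xy.
rewrite !inE => /andP[/eqP fx /eqP fy].
by rewrite -fx -fy network_monotone.
Qed.

(** Keeps the extension inside ['I_s]; a maximum over no [z] is 0, which lies below [s] by
    [s_gt0]. *)
Lemma local_max_lt Z i x (s_gt0 : (0 < s)%N) :
  (\max_(z in Z | local_le i z x) (z i : nat) < s)%N.
Proof.
by elim/big_ind: _ => // a b a_lt b_lt; rewrite gtn_max a_lt.
Qed.

Lemma independent_sub_Fix Z : (0 < s)%N ->
  independent (guessing_graph D s) Z ->
  exists2 f, f \in networks D s & Z \subset Fix f.
Proof.
move=> s_gt0 indZ.
pose f : {ffun conf n s -> conf n s} :=
  [ffun x => [ffun i => Ordinal (local_max_lt Z i x s_gt0)]].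
exists f.
  apply: monotone_network => i x y le_xy; rewrite !ffunE /=.
  (* By transitivity, passing from [x] to [y] can only enlarge the range of the maximum. *)
  apply/bigmax_leqP => z /andP[zZ le_zx].
  apply: (leq_bigmax_cond (F := fun t : conf n s => t i : nat)).
  by rewrite zZ (local_le_trans i x).
apply/subsetP => z zZ; rewrite inE; apply/eqP/ffunP => i; rewrite !ffunE.
(* Independence bounds every term by [z i], and reflexivity makes [z i] one of the terms. *)
apply/val_inj/eqP; rewrite /= eqn_leq; apply/andP; split.
  by apply/bigmax_leqP => t /andP[tZ]; exact: (independent_local_le Z i indZ).
apply: (leq_bigmax_cond (F := fun t : conf n s => t i : nat)).
by rewrite zZ local_le_refl.
Qed.

End Networks.

(** Covers [m = 0] too, where the logarithm is [-oo]; [2 <= s] makes the denominator positive. *)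
Lemma log_base_le (R : realType) (s m k : nat) : (2 <= s)%N -> (m <= k)%N ->
  (log_base R s m <= log_base R s k)%E.
Proof.
move=> hs mk; have ln_s : (0 < ln (s%:R : R))%R by rewrite ln_gt0 // ltr1n.
apply: lee_wpmul2r; first by rewrite inve_ge0 lee_fin ltW.
by rewrite lee_lne ?in_itv /= ?lee_fin ?ler0n ?ler_nat ?leey.
Qed.

Theorem theorem1 (R : realType) (n s : nat) (D : signed_digraph n)
    (hs : (2 <= s)%N) :
  (forall Z : {set conf n s},
     Z != set0 -> independent (guessing_graph D s) Z ->
     exists2 f : {ffun conf n s -> conf n s},
       f \in networks D s & Z \subset Fix f) /\
  guessing_number R D s =
    log_base R s (independence_number (guessing_graph D s)).
Proof.
have s_gt0 : (0 < s)%N by exact: ltnW.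
split=> [Z _|]; first exact: independent_sub_Fix.
apply/eqP; rewrite eq_le; apply/andP; split.
  apply: bigmax_le => [|f fD]; first exact: leNye.
  apply: log_base_le => //.
  exact: (leq_bigmax_cond (F := fun A : {set conf n s} => #|A|))
    (independent_Fix f fD).
(* Some independent set exists, so the independence number is attained by a set [Z]. *)
have ind0 : independent (guessing_graph D s) set0.
  by apply/independentP => x y; rewrite inE.
have [Z indZ ->] : {Z | independent (guessing_graph D s) Z &
    independence_number (guessing_graph D s) = #|Z|}.
  apply: eq_bigmax_cond; apply/card_gt0P; by exists set0.
have [f fD Zf] := independent_sub_Fix Z s_gt0 indZ.
apply: le_trans (le_bigmax_cond _ _ fD).
exact/log_base_le/subset_leq_card.
Qed.
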